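(* Let $N,M\ge 1$ be integers, let $\bm{A}_{\mathrm{intra}}\in\mathbb{R}^{N\times N}$ and $\bm{A}_{\mathrm{inter}}\in\mathbb{R}^{M\times M}$ be matrices with zero diagonal, and let $\bm{\omega}_{\mathrm{inter}}=\big((\omega_{\mathrm{inter}})_1,\dots,(\omega_{\mathrm{inter}})_M\big)\in\mathbb{R}^M$. Let $\bm{\psi}^*=(\psi_1^*,\dots,\psi_N^* )$ be a solution of $$\frac{d\psi_i}{dt}=\sum_{j=1}^{N}(\bm{A}_{\mathrm{intra}})_{ij}\sin(\psi_j-\psi_i),\qquad 1\le i\le N,$$ and let $\bm{\phi}^*=(\phi_1^*,\dots,\phi_M^* )$ be a solution of $$\frac{d\phi_l}{dt}=(\omega_{\mathrm{inter}})_l+\sum_{k=1}^{M}(\bm{A}_{\mathrm{inter}})_{lk}\sin(\phi_k-\phi_l),\qquad 1\le l\le M.$$ Then the composed functions $(\bm{\theta}_l)_i=\psi_i^*+\phi_l^*$ ($1\le l\le M$, $1\le i\le N$) form a solution of the multiplex system with layer-dependent natural frequencies $$\frac{d(\bm{\theta}_l)_i}{dt}=(\omega_{\mathrm{inter}})_l+\sum_{j=1}^{N}(\bm{A}_{\mathrm{intra}})_{ij}\sin\big((\bm{\theta}_l)_j-(\bm{\theta}_l)_i\big)+\sum_{\substack{k=1\\k\ne l}}^{M}\sum_{j=1}^{N}\big((\bm{A}_{\mathrm{inter}})_{lk}\bm{I}_N\big)_{ij}\sin\big((\bm{\theta}_k)_j-(\bm{\theta}_l)_i\big),$$ and for this composed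 solution the Kuramoto order parameters satisfy $R(t)=R_{\mathrm{intra}}(t)R_{\mathrm{inter}}(t)$ for every $t$.
   Context: $\bm{I}_N$ is the $N\times N$ identity matrix. Solutions are differentiable functions of time $t$ on a common time interval; phases are regarded as real numbers (modulo $2\pi$). The Kuramoto order parameters are $$R(t)=\frac{1}{NM}\Big|\sum_{l=1}^{M}\sum_{i=1}^{N}e^{\mathrm{i}(\bm{\theta}_l)_i(t)}\Big|,\qquad R_{\mathrm{intra}}(t)=\frac1N\Big|\sum_{j=1}^{N}e^{\mathrm{i}\psi^*_j(t)}\Big|,\qquad R_{\mathrm{inter}}(t)=\frac1M\Big|\sum_{j=1}^{M}e^{\mathrm{i}\phi^*_j(t)}\Big|.$$ *)

(* Defs.v *)
From HB Require Import structures.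
From mathcomp Require Import all_boot all_order all_algebra.
From mathcomp Require Import all_classical all_reals all_analysis.
From mathcomp Require Import complex.
Set Implicit Arguments.
Unset Strict Implicit.
Unset Printing Implicit Defensive.
Import Order.TTheory GRing.Theory Num.Theory.
Import numFieldNormedType.Exports.
Local Open Scope classical_set_scope.
Local Open Scope ring_scope.
Local Open Scope complex_scope.

(* The difference quotients only use times of J, so this is the one-sided     *)
(* derivative at an endpoint belonging to J, and values of f outside J are    *)
(* irrelevant; inside J it is the library's derivative (has_deriv_onP).       *)
Definition has_deriv_on (R : realType) (J : interval R) (f : R -> R)
    (t d : R) : Prop :=
  h^-1 * (f (h + t) - f t) @[h --> within [set h | h + t \in J] 0^'] --> d.

Lemma has_deriv_onP (R : realType) (J : interval R) (f : R -> R) (t d : R) :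
  [set` J]° t -> has_deriv_on J f t d <-> is_derive t 1 f d.
Proof.
move=> tJ.
have nJ : \forall h \near 0^', [set h | h + t \in J] h.
  apply: nbhs_dnbhs.
  have c : (fun h : R => h + t) @ 0 --> t.
    rewrite -[X in _ --> X](add0r t).
    by apply: cvgD; [exact: cvg_id|exact: cvg_cst].
  exact: (c _ tJ).
have -> : has_deriv_on J f t d <->
    h^-1 *: ((f \o shift t) (h *: 1) - f t) @[h --> 0^'] --> d.
  have E : (fun h => h^-1 *: ((f \o shift t) (h *: 1) - f t)) =
           (fun h => h^-1 * (f (h + t) - f t)).
    by apply/funext => h; rewrite /= /GRing.scale /= mulr1.
  rewrite E /has_deriv_on; split=> H.
    move=> A /H HA;
    by apply: (@filterS2 _ (0 : R)^' _ _ _ _ _ HA nJ) => h k hJ; exact: k.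
  by move=> A /H; apply: (@filterS _ (0 : R)^') => h + _.
split=> [H|[c <-]]; last exact: c.
by split; [apply/cvg_ex; exists d|exact: cvg_lim].
Qed.

(* e^(x + iy) = e^x (cos y + i sin y), R[i] having no exponential             *)
Definition expC (R : realType) (z : R[i]) : R[i] :=
  (expR (complex.Re z))%:C * (cos (complex.Im z) +i* sin (complex.Im z)).

(* The modulus is ComplexField.Normc.normc, valued in R: the norm `|z| of     *)
(* R[i] is valued in R[i].                                                    *)
Definition order_parameter (R : realType) (n : nat) (x : 'I_n -> R -> R)
    (t : R) : R :=
  n%:R^-1 * ComplexField.Normc.normc (\sum_(j < n) expC ('i * (x j t)%:C)).

Definition multiplex_order_parameter (R : realType) (N M : nat)
    (theta : 'I_M -> 'I_N -> R -> R) (t : R) : R :=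
  (N * M)%:R^-1 * ComplexField.Normc.normc
    (\sum_(l < M) \sum_(i < N) expC ('i * (theta l i t)%:C)).

(* Main.v *)
Require Import Defs.
From HB Require Import structures.
From mathcomp Require Import all_boot all_order all_algebra.
From mathcomp Require Import all_classical all_reals all_analysis.
From mathcomp Require Import complex.
Set Implicit Arguments.
Unset Strict Implicit.
Unset Printing Implicit Defensive.
Import Order.TTheory GRing.Theory Num.Theory.
Import numFieldNormedType.Exports.
Local Open Scope ring_scope.

(** All the sines depend only on phase differences.  With
    theta_(l, i) = psi_i + phi_l, two phases of the same layer differ by
    psi_j - psi_i, and two copies of the same node i in different layers differ
    by phi_k - phi_l.  Inter-layer coupling by multiples of the identity links
    only such copies, so the multiplex vector field at (l, i) is the sum of the
    intra-layer field at i and the inter-layer field at l, and differentiation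
    is additive ([has_deriv_onD]).

    For the order parameters, the same additivity turns into a product under
    the exponential ([expC_imagD]): the double sum of
    e^(i (psi_i + phi_l)) factors as a product of two single sums, and the
    modulus is multiplicative. *)

Lemma has_deriv_onD (R : realType) (J : interval R) (f g : R -> R)
    (t df dg : R) :
  has_deriv_on J f t df -> has_deriv_on J g t dg ->
  has_deriv_on J (fun s => f s + g s) t (df + dg).
Proof.
move=> hf hg; rewrite /has_deriv_on.
under eq_fun => h do rewrite opprD addrACA mulrDr.
exact: cvgD hf hg.
Qed.

Lemma expC_imagD (R : realType) (a b : R) :
  expC ('i * (a + b)%:C)%C = expC ('i * a%:C)%C * expC ('i * b%:C)%C.
Proof.
rewrite /expC; simpc => /=; rewrite !expR0 !mul1r cosD sinD.
by congr (_ +i* _)%C; rewrite addrC.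
Qed.

Lemma sum_scalar_mx_row (R : pzRingType) (n : nat) (c : R) (i : 'I_n)
    (F : 'I_n -> R) :
  \sum_(j < n) (c *: (1%:M : 'M[R]_n)) i j * F j = c * F i.
Proof.
rewrite (bigD1 i) //= big1 ?addr0 => [|j ji]; first by rewrite !mxE eqxx mulr1.
by rewrite !mxE eq_sym (negPf ji) mulr0 mul0r.
Qed.

Lemma multiplex_order_parameterM (R : realType) (N M : nat)
    (psi : 'I_N -> R -> R) (phi : 'I_M -> R -> R) (t : R) :
  multiplex_order_parameter (fun l i s => psi i s + phi l s) t =
  order_parameter psi t * order_parameter phi t.
Proof.
rewrite /multiplex_order_parameter /order_parameter natrM invfM mulrACA.
rewrite -ComplexField.Normc.normcM big_distrlr exchange_big /=.
congr (_ * ComplexField.Normc.normc _).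
by apply: eq_bigr => l _; apply: eq_bigr => i _; rewrite expC_imagD.
Qed.

Theorem mainTheorem3 (R : realType) (N M : nat) (hN : (1 <= N)%N)
  (hM : (1 <= M)%N) (A_intra : 'M[R]_N) (A_inter : 'M[R]_M)
  (hA_intra : forall i, A_intra i i = 0)
  (hA_inter : forall l, A_inter l l = 0)
  (omega_inter : 'rV[R]_M) (J : interval R)
  (psi : 'I_N -> R -> R) (phi : 'I_M -> R -> R)
  (hpsi : forall t, t \in J -> forall i,
    has_deriv_on J (psi i) t
      (\sum_(j < N) A_intra i j * sin (psi j t - psi i t)))
  (hphi : forall t, t \in J -> forall l,
    has_deriv_on J (phi l) t
      (omega_inter 0 l +
       \sum_(k < M) A_inter l k * sin (phi k t - phi l t))) :
  let theta : 'I_M -> 'I_N -> R -> R := fun l i t => psi i t + phi l t in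
  (forall t, t \in J -> forall l i,
    has_deriv_on J (theta l i) t
      (omega_inter 0 l +
       \sum_(j < N) A_intra i j * sin (theta l j t - theta l i t) +
       \sum_(k < M | k != l) \sum_(j < N)
         (A_inter l k *: (1%:M : 'M[R]_N)) i j *
           sin (theta k j t - theta l i t))) /\
  (forall t, t \in J ->
    multiplex_order_parameter theta t =
    order_parameter psi t * order_parameter phi t).
Proof.
move=> theta; split=> t tJ; last exact: multiplex_order_parameterM.
move=> l i; have := has_deriv_onD (hpsi t tJ i) (hphi t tJ l).
rewrite addrCA addrA; congr has_deriv_on; congr (_ + _ + _).
  apply: eq_bigr => j _; congr (_ * sin _).
  by rewrite /theta opprD addrACA subrr addr0.
(* The excluded index k = l contributes nothing, A_inter having zero diagonal. *)
rewrite (bigD1 l) //= hA_inter mul0r add0r; apply: eq_bigr => k _.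
rewrite sum_scalar_mx_row /theta; congr (_ * sin _).
by rewrite opprD addrACA subrr add0r.
Qed.
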